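(* Let $\mathcal{C}\subset\mathbb{R}^p$ be a closed bounded convex set, let $\ell(\cdot;d):\mathcal{C}\to\mathbb{R}$ be convex, $L$-Lipschitz and $\Delta$-strongly convex ($\Delta>0$) for every $d$ in the data universe, and let $\epsilon>0$. Let $\mathcal{A}^{\epsilon/2}_{\sf gen-Lip}$ be any algorithm that takes a data set $\mathcal{D}$ of size $n$, the loss $\ell$, the privacy parameter $\epsilon/2$ and a convex set $\tilde{\mathcal{C}}\subseteq\mathcal{C}$, outputs a point of $\tilde{\mathcal{C}}$, and is $\frac{\epsilon}{2}$-differentially private (for each fixed $\tilde{\mathcal{C}}$). Then the output-perturbation-based generic algorithm described in the context is $\epsilon$-differentially private.
   Context: Lipschitz and strong convexity are with respect to the Euclidean norm; $f$ is $\Delta$-strongly convex on $\mathcal{C}$ if $f(y)\ge f(x)+\langle z,y-x\rangle+\frac{\Delta}{2}\|y-x\|_2^2$ for all $x,y\in\mathcal{C}$ and all subgradients $z$ of $f$ at $x$. $\Pi_{\mathcal{C}}$ denotes Euclidean projection onto $\mathcal{C}$, and $\mathcal{L}(\theta;\mathcal{D})=\sum_{i=1}^n\ell(\theta;d_i)$ for $\mathcal{D}=\{d_1,\dots,d_n\}$. Output perturbation $\mathcal{A}^{\epsilon'}_{\sf out-pert}$ with privacy parameter $\epsilon'$ and radius parameter $\zeta$: compute $\theta^*=\arg\min_{\theta\in\mathcal{C}}\mathcal{L}(\theta;\mathcal{D})$; set $\theta_0=\Pi_{\mathcal{C}}(\theta^*+b)$, where $b\in\mathbb{R}^p$ is a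 random vector with density proportional to $e^{-\frac{n\Delta\epsilon'}{2L}\|b\|_2}$; output the set $\mathcal{C}_0=\{\theta\in\mathcal{C}:\|\theta-\theta_0\|_2\le\zeta\frac{2Lp}{\Delta\epsilon' n}\}$. Output-perturbation-based generic algorithm (inputs $\mathcal{D},\ell,\Delta,\epsilon,\mathcal{C}$): 1. Run $\mathcal{A}^{\epsilon/2}_{\sf out-pert}$ (i.e. $\epsilon'=\epsilon/2$) with radius parameter $\zeta=3\log(n)$ to obtain $\mathcal{C}_0$. 2. Run $\mathcal{A}^{\epsilon/2}_{\sf gen-Lip}$, with fresh randomness, on $\mathcal{D}$, $\ell$, privacy parameter $\epsilon/2$ and convex set $\mathcal{C}_0$, and output the result $\theta^{priv}$. Differential privacy: two data sets of size $n$ are neighbors if they differ in one entry. A randomized algorithm $\mathcal{A}$ is $\epsilon$-differentially private if for all neighboring $\mathcal{D},\mathcal{D}'$ and all events $S$ in the output space, $\Pr(\mathcal{A}(\mathcal{D})\in S)\le e^{\epsilon}\Pr(\mathcal{A}(\mathcal{D}')\in S)$. *)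

(* Defs.v *)
From HB Require Import structures.
From mathcomp Require Import all_boot all_order all_algebra.
From mathcomp Require Import all_classical all_reals all_analysis.
From mathcomp Require Import measurable_realfun.

Set Implicit Arguments.
Unset Strict Implicit.
Unset Printing Implicit Defensive.
Import Order.TTheory GRing.Theory Num.Theory.
Import numFieldNormedType.Exports.

Local Open Scope classical_set_scope.
Local Open Scope ring_scope.

Section measurable_rV.
Context {R : realType} (p : nat).

Let coord (j : 'I_p) (x : 'rV[R]_p) : R := x ord0 j.

Let rV_set0 : g_sigma_preimage coord set0.
Proof. exact: sigma_algebra0. Qed.

Let rV_setC A : g_sigma_preimage coord A -> g_sigma_preimage coord (~` A).
Proof. exact: sigma_algebraC. Qed.

Let rV_bigcup (F : (set 'rV[R]_p)^nat) :
  (forall i, g_sigma_preimage coord (F i)) ->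
  g_sigma_preimage coord (\bigcup_i F i).
Proof. exact: sigma_algebra_bigcup. Qed.

(* The sigma-algebra generated by the coordinates, as the library does for
   tuples; on R^p this is the Borel sigma-algebra. *)
HB.instance Definition _ := @isMeasurable.Build default_measure_display
  'rV[R]_p (g_sigma_preimage coord) rV_set0 rV_setC rV_bigcup.

Lemma measurable_coord (j : 'I_p) :
  measurable_fun [set: 'rV[R]_p] (fun x => x ord0 j).
Proof.
move=> _ Y mY; rewrite setTI; apply: sub_sigma_algebra => /=.
rewrite -bigcup_seq/=; exists j => /=; first by rewrite mem_index_enum.
by exists Y => //; rewrite setTI.
Qed.

Lemma measurable_fun_rV d (T : measurableType d) (f : T -> 'rV[R]_p) :
  (forall j, measurable_fun [set: T] (fun x => f x ord0 j)) ->
  measurable_fun [set: T] f.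
Proof.
move=> mf; suff : g_sigma_preimage (fun j => coord j \o f) `<=` measurable.
  by rewrite g_sigma_preimage_comp => prefS _ A mA; apply: prefS; exists A.
apply: smallest_sub; first exact: sigma_algebra_measurable.
rewrite -bigcup_seq; apply: bigcup_sub => j _.
by move=> A [B mB <-]; exact: mf.
Qed.

End measurable_rV.

Section lebesgue_rV.
Context {R : realType}.

Definition cons_rV p (x : measurableTypeR R * 'rV[R]_p) : 'rV[R]_p.+1 :=
  \row_j (if unlift ord0 j is Some k then x.2 ord0 k else x.1).

Definition uncons_rV p (v : 'rV[R]_p.+1) : measurableTypeR R * 'rV[R]_p :=
  (v ord0 ord0, \row_k v ord0 (lift ord0 k)).

Lemma cons_rVK p : cancel (@cons_rV p) (@uncons_rV p).
Proof.
move=> [x v]; rewrite /uncons_rV mxE unlift_none; congr pair.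
by apply/rowP => k; rewrite !mxE liftK.
Qed.

Lemma measurable_cons_rV p : measurable_fun setT (@cons_rV p).
Proof.
apply: measurable_fun_rV => j; under eq_fun do rewrite mxE.
case: (unliftP ord0 j) => [k _|_]; last exact: measurable_fst.
exact: (measurableT_comp (measurable_coord k) measurable_snd).
Qed.

Lemma measurable_uncons_rV p : measurable_fun setT (@uncons_rV p).
Proof.
apply/measurable_fun_pairP; split; first exact: measurable_coord.
apply: measurable_fun_rV => k /=; under eq_fun do rewrite mxE.
exact: measurable_coord.
Qed.

Section step.
Variables (p : nat) (m : {sigma_finite_measure set 'rV[R]_p -> \bar R}).

Definition lebesgue_step : set 'rV[R]_p.+1 -> \bar R :=
  pushforward (lebesgue_measure \x m)%E (@cons_rV p).

HB.instance Definition _ := Measure.copy lebesgue_step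
  (measure_function_pushforward__canonical__measure_function_Measure
     (@lebesgue_measure R \x m)%E (@measurable_cons_rV p)).

Let lebesgue_step_sigma_finite : sigma_finite setT lebesgue_step.
Proof.
have /sigma_finiteP[F [FT ndF Foo]] := sigma_finiteT (@lebesgue_measure R).
have /sigma_finiteP[G [GT ndG Goo]] := sigma_finiteT m.
exists (fun n => @uncons_rV p @^-1` (F n `*` G n)).
  rewrite -preimage_bigcup (_ : \bigcup_n _ = setT) ?preimage_setT//.
  apply/seteqP; split=> // -[x v] _.
  have [i _ Fx] : (\bigcup_i F i) x by rewrite -FT.
  have [k _ Gv] : (\bigcup_k G k) v by rewrite -GT.
  exists (maxn i k) => //; split.
  - exact: (subsetPset _ _ (ndF _ _ (leq_maxl i k))).
  - exact: (subsetPset _ _ (ndG _ _ (leq_maxr i k))).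
move=> n; have [mF Fn] := Foo n; have [mG Gn] := Goo n; split.
  rewrite -[X in measurable X]setTI; apply: measurable_uncons_rV => //.
  exact: measurableX.
rewrite /lebesgue_step /pushforward -comp_preimage.
rewrite (_ : _ \o _ = id) ?preimage_id; last exact/funext/cons_rVK.
by rewrite product_measure1E// lte_mul_pinfty// ge0_fin_numE.
Qed.

HB.instance Definition _ := Measure_isSigmaFinite.Build _ _ _ lebesgue_step
  lebesgue_step_sigma_finite.
End step.

(* Lebesgue measure on R^p: the unit mass on R^0, and the product of the
   one-dimensional Lebesgue measure with that of R^p on R^(p+1). *)
Fixpoint lebesgue_rV p : {sigma_finite_measure set 'rV[R]_p -> \bar R} :=
  if p is p'.+1 then lebesgue_step (lebesgue_rV p') else \d_(0 : 'rV[R]_0).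

End lebesgue_rV.

Section euclidean.
Context {R : realType} {p : nat}.
Implicit Types (u v x y z : 'rV[R]_p) (C : set 'rV[R]_p) (f : 'rV[R]_p -> R).

Definition dotprod u v : R := \sum_j u ord0 j * v ord0 j.

(* The library's norm `|x| on 'rV is the sup norm. *)
Definition enorm x : R := Num.sqrt (dotprod x x).

(* Functions on C are total functions of which only the values on C matter. *)
Definition elipschitz_on C (L : R) f :=
  forall x y, C x -> C y -> `|f x - f y| <= L * enorm (x - y).

Definition subgradient_on C f x z :=
  forall y, C y -> f x + dotprod z (y - x) <= f y.

Definition strongly_convex_on C (Delta : R) f :=
  forall x y z, C x -> C y -> subgradient_on C f x z ->
    f x + dotprod z (y - x) + Delta / 2 * enorm (y - x) ^+ 2 <= f y.

(* An unspecified minimizer; the default value 0 is used only if there is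
   none. *)
Definition argmin_on C f : 'rV[R]_p :=
  xget 0 [set x | C x /\ forall y, C y -> f x <= f y].

Definition eproj C x : 'rV[R]_p := argmin_on C (fun y => enorm (y - x)).

Definition has_density_proportional_to
    (P : probability 'rV[R]_p R) (g : 'rV[R]_p -> R) :=
  exists2 k : R, 0 < k & forall A, measurable A ->
    (P A = \int[lebesgue_rV p]_(x in A) (k * g x)%:E)%E.

(* "P outputs a point of A"; this is P A = 1 when A is measurable, but convex
   sets need not be Borel. *)
Definition outputs_in (P : probability 'rV[R]_p R) (A : set 'rV[R]_p) :=
  forall S, measurable S -> S `&` A = set0 -> P S = 0%E.

End euclidean.

Section privacy.
Context {R : realType} {X : Type} {n : nat}.

Definition neighbors (D D' : n.-tuple X) :=
  exists i, tnth D i <> tnth D' i /\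
    forall j, j != i -> tnth D j = tnth D' j.

(* A randomized algorithm is given by the law of its output on each data set. *)
Definition differentially_private d (T : measurableType d) (eps : R)
    (A : n.-tuple X -> set T -> \bar R) :=
  forall D D', neighbors D D' -> forall S, measurable S ->
    (A D S <= (expR eps)%:E * A D' S)%E.

End privacy.

(* Up to normalization; n is the size of the data sets. *)
Definition out_pert_noise_density {R : realType} {p : nat} (n : nat)
    (L Delta eps' : R) (b : 'rV[R]_p) : R :=
  expR (- (n%:R * Delta * eps' / (2 * L) * enorm b)).

Section algorithms.
Context {R : realType} {X : Type} {p n : nat}.

Definition loss := X -> 'rV[R]_p -> R.

Definition empirical_loss (l : loss) (D : n.-tuple X) : 'rV[R]_p -> R :=
  fun theta => \sum_(i < n) l (tnth D i) theta.

(* Output perturbation, as a function of the realization b of its noise. *)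
Definition out_pert (C : set 'rV[R]_p) (l : loss) (L Delta eps' zeta : R)
    (D : n.-tuple X) (b : 'rV[R]_p) : set 'rV[R]_p :=
  let theta_star := argmin_on C (empirical_loss l D) in
  let theta0 := eproj C (theta_star + b) in
  [set theta | C theta /\
    enorm (theta - theta0) <= zeta * (2 * L * p%:R / (Delta * eps' * n%:R))].

(* Inputs: data set, loss, privacy parameter, convex set; the result is the law
   of the output. *)
Definition generic_algorithm :=
  n.-tuple X -> loss -> R -> set 'rV[R]_p -> probability 'rV[R]_p R.

Section out_pert_generic.
Variables (Agen : generic_algorithm) (C : set 'rV[R]_p) (l : loss).
Variables (L Delta eps : R).

Definition generic_step (D : n.-tuple X) (b : 'rV[R]_p) :
    probability 'rV[R]_p R :=
  Agen D l (eps / 2) (out_pert C l L Delta (eps / 2) (3 * ln n%:R) D b).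

(* The law of the output: fresh randomness in the second step means that,
   given the noise b, the output has law generic_step D b. *)
Definition out_pert_generic (noise : probability 'rV[R]_p R)
    (D : n.-tuple X) (S : set 'rV[R]_p) : \bar R :=
  (\int[noise]_b generic_step D b S)%E.

End out_pert_generic.

End algorithms.

(* Main.v *)
(** The idea is composition.  Each loss satisfies the Jensen form of strong
convexity, hence so does their sum with modulus [n * Delta], and the minimizers
for two neighboring data sets are at distance at most [2 L / (n Delta)].
Translating the noise by that much multiplies its density by at most
[e^(eps/2)], so the law of the center of the ball moves by at most this factor.
For a fixed realization of the ball, the second step costs another
[e^(eps/2)]. *)
Require Import Defs.
From mathcomp Require Import all_boot all_order all_algebra.
From mathcomp Require Import all_classical all_reals all_analysis.
From mathcomp Require Import measurable_realfun.
From mathcomp Require Import ring lra.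

Import Order.TTheory GRing.Theory Num.Theory.
Import numFieldNormedType.Exports.

Local Open Scope classical_set_scope.
Local Open Scope ring_scope.

(** * Translation invariance of Lebesgue measure on R^p *)

Lemma ge0_integral_invariant d (T : measurableType d) (R : realType)
    (m : {measure set T -> \bar R}) (phi : T -> T) :
  measurable_fun setT phi ->
  (forall A, measurable A -> m (phi @^-1` A) = m A) ->
  forall (D : set T) (f : T -> \bar R), measurable D -> measurable_fun D f ->
  (forall x, (0 <= f x)%E) ->
  (\int[m]_(x in phi @^-1` D) f (phi x) = \int[m]_(x in D) f x)%E.
Proof.
move=> mphi inv D f mD mf f0.
rewrite -(@ge0_integral_pushforward _ _ _ _ _ _ mphi m D f)//.
apply: eq_measure_integral => A mA _ /=; rewrite -[RHS]inv//.
Qed.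

(** The image of Lebesgue measure under a translation agrees with it on half-open intervals, and
    these determine it. *)
Lemma lebesgue_measure_translate (R : realType) (c : R) (A : set R) :
  measurable A ->
  lebesgue_measure ((fun x => x + c) @^-1` A) = lebesgue_measure A.
Proof.
have mc : measurable_fun (setT : set (measurableTypeR R))
    ((fun x => x + c) : measurableTypeR R -> measurableTypeR R).
  exact: measurable_funD.
move=> mA; apply/esym.
apply: (@lebesgue_measure_unique R
  (measure_function_pushforward__canonical__measure_function_Measure
    lebesgue_measure mc)) => // _ [[a b] _ <-] /=.
rewrite /pushforward.
have -> : (fun x => x + c) @^-1` `]a, b] = `]a - c, b - c]%classic.
  by apply/seteqP; split=> x /=; rewrite !in_itv/= lerBrDr ltrBlDr.
rewrite !lebesgue_measure_itv/= !lte_fin ltrD2r; case: ifPn => // _.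
by rewrite -!EFinB; congr EFin; ring.
Qed.

Section translation.
Context {R : realType}.

Lemma measurable_translate p (c : 'rV[R]_p) :
  measurable_fun setT (fun x : 'rV[R]_p => x + c).
Proof.
apply: measurable_fun_rV => j; under eq_fun do rewrite mxE.
by apply: measurable_funD => //; exact: measurable_coord.
Qed.

(** Induction on the dimension. The product measure integrates the measures of sections: the
    induction hypothesis absorbs the shift of each section, and one-dimensional invariance absorbs
    the shift of the first coordinate. *)
Lemma lebesgue_rV_translate p (c : 'rV[R]_p) (A : set 'rV[R]_p) :
  measurable A -> lebesgue_rV p ((fun x => x + c) @^-1` A) = lebesgue_rV p A.
Proof.
elim: p c A => [|p IH] c A mA.
  congr (lebesgue_rV 0 _).
  by apply/seteqP; split=> x /=; rewrite [c]thinmx0 addr0.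
rewrite /= /lebesgue_step /pushforward /product_measure1.
set B := cons_rV (p:=p) @^-1` A.
have mB : measurable B.
  by rewrite -[B]setTI; exact: measurable_cons_rV.
pose c0 : R := c ord0 ord0.
pose c1 : 'rV[R]_p := \row_k c ord0 (lift ord0 k).
transitivity (\int[@lebesgue_measure R]_x
   (lebesgue_rV p \o xsection B) ((x : R) + c0)%R)%E.
  apply: eq_integral => x _ /=.
  rewrite -[RHS](IH c1); last exact: measurable_xsection.
  have shift v : cons_rV (x, v) + c = cons_rV (x + c0, v + c1).
    by apply/rowP => j; rewrite !mxE; case: unliftP => [k ->|->]; rewrite ?mxE.
  congr (lebesgue_rV p _).
  by apply/seteqP; split=> v; rewrite /xsection /= !inE /B/= shift.
have mc : measurable_fun (setT : set (measurableTypeR R))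
    ((fun x => x + c0) : measurableTypeR R -> measurableTypeR R).
  exact: measurable_funD.
apply: (@ge0_integral_invariant _ _ _ (@lebesgue_measure R) _ mc _ setT) => //.
- by move=> D mD; exact: lebesgue_measure_translate.
- exact: measurable_fun_xsection.
Qed.

End translation.

(** * Effect of a translation on a measure with a density *)

Section quasi_invariance.
Context {R : realType} {p : nat}.
Variables (P : probability 'rV[R]_p R) (g : 'rV[R]_p -> R) (c : 'rV[R]_p).
Variable M : {nonneg R}.
Hypotheses (Pg : has_density_proportional_to P g).
Hypotheses (mg : measurable_fun setT g) (g0 : forall x, 0 <= g x).
Hypothesis gM : forall x, g (x - c) <= M%:num * g x.

(** A change of variables moves the translation from the set to the density, where [gM] bounds it
    pointwise. *)
Lemma density_translate_le (A : set 'rV[R]_p) : measurable A ->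
  (P ((fun x => (x + c)%R) @^-1` A) <= M%:num%:E * P A)%E.
Proof.
move=> mA; have [k k0 Pk] := Pg; rewrite !Pk//; last first.
  by rewrite -[X in measurable X]setTI; exact: measurable_translate.
have mkg : measurable_fun setT (fun x => (k * g x)%:E).
  by apply/measurable_EFinP; exact: measurable_funM.
have mkgc : measurable_fun setT (fun x : 'rV[R]_p => (k * g (x - c))%:E).
  exact: measurableT_comp mkg (measurable_translate _ (- c)).
(* Adding and subtracting [c] exhibits the integrand as a function of [x + c], ready for the change
   of variables. *)
rewrite (eq_integral (fun x : 'rV[R]_p => (k * g (x + c - c))%:E)); last first.
  by move=> x _; rewrite addrK.
rewrite (@ge0_integral_invariant _ _ _ _ (fun x : 'rV[R]_p => x + c) _ _ A
  (fun x : 'rV[R]_p => (k * g (x - c))%:E))//.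
- rewrite -ge0_integralZl//.
  + apply: ge0_le_integral => //.
    * by move=> x _; rewrite lee_fin mulr_ge0// ltW.
    * exact: measurable_funTS.
    * by apply: measurable_funTS; exact: measurable_funeM.
    * by move=> x _; rewrite -EFinM lee_fin mulrCA ler_pM2l.
  + exact: measurable_funTS.
  + by move=> x _; rewrite lee_fin mulr_ge0// ltW.
- exact: measurable_translate.
- by move=> B mB; exact: lebesgue_rV_translate.
- exact: measurable_funTS.
- by move=> x; rewrite lee_fin mulr_ge0// ltW.
Qed.

(** The left side integrates [f] against the image of [P] under the translation, a measure dominated
    by [M] times [P] on every measurable set. *)
Lemma integral_density_translate_le (f : 'rV[R]_p -> \bar R) :
  measurable_fun setT f -> (forall x, (0 <= f x)%E) ->
  (\int[P]_x f (x + c)%R <= M%:num%:E * \int[P]_x f x)%E.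
Proof.
move=> mf f0; have mc := measurable_translate _ c.
rewrite -ge0_integral_mscale//.
rewrite -[leLHS](@ge0_integral_pushforward _ _ _ _ _ _ mc P setT f)//.
by apply: ge0_le_measure_integral => // S mS; exact: density_translate_le.
Qed.

End quasi_invariance.

(** * Euclidean inner product and norm *)

Section euclidean_norm.
Context {R : realType} {p : nat}.
Implicit Types (u v w x y : 'rV[R]_p) (a : R).

Lemma dotprodC u v : dotprod u v = dotprod v u.
Proof. by apply: eq_bigr => j _; rewrite mulrC. Qed.

Lemma dotprodDl u v w : dotprod (u + v) w = dotprod u w + dotprod v w.
Proof. by rewrite -big_split; apply: eq_bigr => j _; rewrite mxE mulrDl. Qed.

Lemma dotprodZl a u v : dotprod (a *: u) v = a * dotprod u v.
Proof. by rewrite mulr_sumr; apply: eq_bigr => j _; rewrite mxE mulrA. Qed.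

Lemma dotprodDr u v w : dotprod u (v + w) = dotprod u v + dotprod u w.
Proof. by rewrite dotprodC dotprodDl !(dotprodC u). Qed.

Lemma dotprodZr a u v : dotprod u (a *: v) = a * dotprod u v.
Proof. by rewrite dotprodC dotprodZl dotprodC. Qed.

Lemma dotprodNl u v : dotprod (- u) v = - dotprod u v.
Proof. by rewrite -scaleN1r dotprodZl mulN1r. Qed.

Lemma dotprodNr u v : dotprod u (- v) = - dotprod u v.
Proof. by rewrite dotprodC dotprodNl dotprodC. Qed.

Definition dotprodE :=
  (dotprodDl, dotprodDr, dotprodNl, dotprodNr, dotprodZl, dotprodZr).

Lemma dotprod_ge0 u : 0 <= dotprod u u.
Proof. by apply: sumr_ge0 => j _; rewrite -expr2 sqr_ge0. Qed.

Lemma enorm_ge0 u : 0 <= enorm u.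
Proof. exact: sqrtr_ge0. Qed.

Lemma sqr_enorm u : enorm u ^+ 2 = dotprod u u.
Proof. exact/sqr_sqrtr/dotprod_ge0. Qed.

Lemma enorm0 : enorm (0 : 'rV[R]_p) = 0.
Proof. by rewrite /enorm -(scale0r 0) dotprodZl mul0r sqrtr0. Qed.

Lemma enormN u : enorm (- u) = enorm u.
Proof. by rewrite /enorm dotprodNl dotprodNr opprK. Qed.

Lemma enormB u v : enorm (u - v) = enorm (v - u).
Proof. by rewrite -enormN opprB. Qed.

Lemma enormZ a u : 0 <= a -> enorm (a *: u) = a * enorm u.
Proof.
move=> a0; rewrite /enorm dotprodZl dotprodZr mulrA -expr2 sqrtrM ?sqr_ge0//.
by rewrite sqrtr_sqr ger0_norm.
Qed.

Lemma enorm_eq0 u : enorm u = 0 -> u = 0.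
Proof.
move=> u0; have : dotprod u u = 0 by rewrite -sqr_enorm u0 expr0n.
move=> /eqP; rewrite psumr_eq0 => [/allP u00|j _]; last first.
  by rewrite -expr2 sqr_ge0.
apply/rowP => j; rewrite mxE; apply/eqP; rewrite -sqrf_eq0 expr2.
exact: u00 (mem_index_enum _).
Qed.

(** Cauchy-Schwarz: for nonzero [v], expand the squared norm of |v|^2 u - <u,v> v, which equals
    |v|^2 (|u|^2 |v|^2 - <u,v>^2). *)
Lemma dotprod_le_enorm u v : dotprod u v <= enorm u * enorm v.
Proof.
have [v0|v0] := eqVneq (enorm v) 0.
  by rewrite v0 (enorm_eq0 v v0) -(scale0r 0) dotprodZr mul0r mulr0.
have vp : 0 < enorm v by rewrite lt_neqAle eq_sym v0 enorm_ge0.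
apply: le_trans (ler_norm _) _.
rewrite -ler_sqr ?nnegrE ?mulr_ge0 ?enorm_ge0// exprMn real_normK ?num_real//.
have := dotprod_ge0 (enorm v ^+ 2 *: u - dotprod u v *: v).
rewrite !dotprodE (dotprodC v u) -!sqr_enorm => h.
have : 0 <= enorm v ^+ 2 * (enorm u ^+ 2 * enorm v ^+ 2 - dotprod u v ^+ 2).
  by move: h; congr (_ <= _); ring.
by rewrite pmulr_rge0 ?exprn_gt0// subr_ge0.
Qed.

Lemma enormD u v : enorm (u + v) <= enorm u + enorm v.
Proof.
rewrite -ler_sqr ?nnegrE ?addr_ge0 ?enorm_ge0//.
have := dotprod_le_enorm u v.
rewrite sqrrD !sqr_enorm !dotprodE (dotprodC v u); lra.
Qed.

(** Links the Euclidean norm to the sup norm that carries the topology, so that Euclidean Lipschitz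
    bounds yield continuity. *)
Lemma enorm_le_norm u : enorm u <= Num.sqrt p%:R * `|u|.
Proof.
rewrite -ler_sqr ?nnegrE ?mulr_ge0 ?enorm_ge0 ?sqrtr_ge0//.
rewrite exprMn sqr_enorm sqr_sqrtr ?ler0n//.
rewrite -[p in p%:R]card_ord -sumr_const mulr_suml; apply: ler_sum => j _.
rewrite mul1r -expr2 -[leLHS]real_normK ?num_real// ler_sqr ?nnegrE//.
rewrite [leRHS]mx_normrE; apply/bigmax_geP; right => /=.
by exists (ord0, j).
Qed.

Lemma measurable_enorm : measurable_fun setT (@enorm R p).
Proof.
apply: (measurableT_comp (continuous_measurable_fun (@sqrt_continuous R))).
apply: measurable_sum => j; apply: measurable_funM; exact: measurable_coord.
Qed.

End euclidean_norm.

(** * Strong convexity, subgradients and minimizers *)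

Lemma affine_ge0 (R : realFieldType) (a b : R) :
  (forall t, 0 < t -> t < 1 -> 0 <= a + t * b) -> 0 <= a.
Proof.
move=> h; rewrite leNgt; apply/negP => a0.
have d0 : 0 < 1 + `|b| - a by have := normr_ge0 b; lra.
(* This [t] is small enough for the negative [a] to outweigh [t * b]; the denominator is positive
   whatever the sign of [b]. *)
have t0 : 0 < - a / (1 + `|b| - a) by rewrite divr_gt0// oppr_gt0.
have t1 : - a / (1 + `|b| - a) < 1.
  by rewrite ltr_pdivrMr// mul1r; have := normr_ge0 b; lra.
have := h _ t0 t1; rewrite leNgt => /negP; apply.
have -> : a + - a / (1 + `|b| - a) * b =
    a * (1 + `|b| - a - b) / (1 + `|b| - a).
  by field; rewrite gt_eqF.
rewrite ltr_pdivrMr// mul0r nmulr_rlt0//.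
by have := ler_norm b; lra.
Qed.

Section convex_optimization.
Context {R : realType} {p : nat}.
Implicit Types (C : set 'rV[R]_p) (f : 'rV[R]_p -> R) (t L Delta : R).

Lemma convex_setP C : convex_set C -> forall t x y, 0 <= t -> t <= 1 ->
  C x -> C y -> C ((1 - t) *: x + t *: y).
Proof.
move=> cC t x y t0 t1 Cx Cy.
have := @cC y x (Itv01 t0 t1); rewrite !inE => /(_ Cy Cx).
by rewrite /conv/= addrC.
Qed.

Lemma convex_functionP C f : convex_function C f ->
  forall t x y, 0 <= t -> t <= 1 -> C x -> C y ->
  f ((1 - t) *: x + t *: y) <= (1 - t) * f x + t * f y.
Proof.
move=> cf t x y t0 t1 Cx Cy.
have := @cf (Itv01 t0 t1) y x; rewrite !inE => /(_ Cy Cx).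
by rewrite /conv/= addrC [leRHS]addrC.
Qed.

(** Lets the privacy hypothesis on the second stage be applied to the set output by the first. *)
Lemma convex_setI_ball C c r : convex_set C ->
  convex_set [set x | C x /\ enorm (x - c) <= r].
Proof.
move=> cC x y t; rewrite !inE => -[Cx xr] [Cy yr]; split.
  by apply/set_mem/cC; rewrite inE.
change (enorm (t%:num *: x + (1 - t%:num) *: y - c) <= r).
have -> : t%:num *: x + (1 - t%:num) *: y - c =
    t%:num *: (x - c) + (1 - t%:num) *: (y - c).
  by apply/rowP => j; rewrite !mxE; ring.
have t0 : 0 <= t%:num by [].
have t1 : 0 <= 1 - t%:num by rewrite subr_ge0.
apply: le_trans (enormD _ _) _; rewrite !enormZ//; nra.
Qed.

Lemma elipschitz_within_continuous C L f : 0 <= L ->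
  elipschitz_on C L f -> {within C, continuous f}.
Proof.
move=> L0 fL; apply/subspace_continuousP => x Cx; apply/cvgrPdist_lt => e e0.
(* The summand 1 keeps the denominator positive when [L] or [p] is zero. *)
have d0 : 0 < e / (L * Num.sqrt p%:R + 1).
  by rewrite divr_gt0// ltr_wpDl// mulr_ge0 ?sqrtr_ge0.
apply: filterS (nbhs_ball_norm x (PosNum d0)) => y /= xy Cy.
apply: le_lt_trans (fL _ _ Cx Cy) _.
apply: (@le_lt_trans _ _ (L * (Num.sqrt p%:R * `|x - y|))).
  by apply: ler_wpM2l => //; exact: enorm_le_norm.
rewrite mulrA; apply: (@le_lt_trans _ _ ((L * Num.sqrt p%:R + 1) * `|x - y|)).
  by rewrite ler_wpM2r// lerDl.
by rewrite mulrC -ltr_pdivlMr// ltr_wpDl// mulr_ge0 ?sqrtr_ge0.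
Qed.

(** By the extreme value theorem a minimizer exists, so [argmin_on] does not fall back on its
    default value. *)
Lemma argmin_onP C f : C !=set0 -> compact C -> {within C, continuous f} ->
  C (argmin_on C f) /\ forall y, C y -> f (argmin_on C f) <= f y.
Proof.
move=> C0 cC cf; have [w wC wmin] := compact_EVT_min C0 cC cf.
apply: (@xgetPex _ 0 [set x | C x /\ forall y, C y -> f x <= f y]).
exists w; split; first exact: set_mem.
by move=> y Cy; apply: wmin; exact: mem_set.
Qed.

Lemma elipschitz_enormB c C : elipschitz_on C 1 (fun y => enorm (y - c)).
Proof.
move=> x y _ _; rewrite mul1r ler_norml.
have h1 := enormD (x - y) (y - c); have h2 := enormD (y - x) (x - c).
rewrite subrKA in h1; rewrite subrKA enormB in h2.
by apply/andP; split; lra.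
Qed.

Lemma eproj_in C c : C !=set0 -> compact C -> C (eproj C c).
Proof.
move=> C0 cC; apply: (argmin_onP _ _ C0 cC _).1.
exact: elipschitz_within_continuous ler01 (elipschitz_enormB c C).
Qed.

Lemma enormB_sqr_within_continuous C c :
  {within C, continuous (fun y => enorm (y - c) ^+ 2)}.
Proof.
have cf := elipschitz_within_continuous _ _ _ ler01 (elipschitz_enormB c C).
by move=> x; apply: (continuousM (cf x) (cf x)).
Qed.

(** Compare [w] with the point at parameter [t] on the segment from [w] to [y], bound [f] there by
    convexity, and divide by [t]. The quadratic term leaves a remainder c/2 t |y - w|^2, which
    [affine_ge0] removes as [t] tends to 0. *)
Lemma min_subgradient C f c m w : convex_set C -> convex_function C f ->
  C w ->
  (forall y, C y ->
     f w + c / 2 * enorm (w - m) ^+ 2 <= f y + c / 2 * enorm (y - m) ^+ 2) ->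
  subgradient_on C f w (c *: (m - w)).
Proof.
move=> cC cf Cw wmin y Cy; rewrite -subr_ge0.
apply: (@affine_ge0 _ _ (c / 2 * enorm (y - w) ^+ 2)) => t t0 t1.
have Cz := convex_setP _ cC t w y (ltW t0) (ltW t1) Cw Cy.
have := convex_functionP _ _ cf t w y (ltW t0) (ltW t1) Cw Cy.
have := wmin _ Cz.
have -> : (1 - t) *: w + t *: y - m = (w - m) + t *: (y - w).
  by apply/rowP => j; rewrite !mxE; ring.
rewrite -[m - w]opprB !sqr_enorm.
move: (w - m) (y - w) => u v; rewrite !dotprodE (dotprodC v u) => h1 h2.
rewrite -(pmulr_rge0 _ t0); nra.
Qed.

(* The strong convexity hypothesis only speaks about points having a
   subgradient relative to [C].  Such points are found arbitrarily close to any
   [m] in [C] by minimizing [f y + c / 2 * |y - m|^2], which spares a separation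
   theorem. *)
Lemma prox_subgradient C L f c m :
  compact C -> convex_set C -> 0 <= L -> elipschitz_on C L f ->
  convex_function C f -> 0 < c -> C m ->
  exists w, [/\ C w, subgradient_on C f w (c *: (m - w)) &
    enorm (m - w) <= 2 * L / c].
Proof.
move=> kC cC L0 fL cf c0 Cm.
pose phi y := f y + c / 2 * enorm (y - m) ^+ 2.
have cphi : {within C, continuous phi}.
  move=> x; apply: cvgD.
    exact: (elipschitz_within_continuous _ _ _ L0 fL).
  by apply: cvgMl_tmp; exact: enormB_sqr_within_continuous.
have [Cw wmin] := argmin_onP C phi (ex_intro _ m Cm) kC cphi.
set w := argmin_on C phi in Cw wmin; exists w; split => //.
  exact: min_subgradient.
(* With r = |m - w|, comparing [phi] at [w] and [m] gives c/2 r^2 <= f m - f w <= L r; it remains to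
   cancel [r]. *)
have := wmin _ Cm; rewrite /phi subrr enorm0 expr0n/= mulr0 addr0 enormB => h.
have := fL _ _ Cm Cw; have := ler_norm (f m - f w); have := enorm_ge0 (m - w).
move: (enorm _) h => r h r0 h1 h2; rewrite ler_pdivlMr//.
have [->|r1] := eqVneq r 0; first by rewrite mul0r mulr_ge0.
have rp : 0 < r by rewrite lt_neqAle eq_sym r1.
rewrite -(ler_pM2l rp); nra.
Qed.

(** Being free of subgradients, this form adds up over a sum of losses, whereas a subgradient of the
    sum would first have to be split among the summands. *)
Definition strongly_convex_jensen C K f :=
  forall t x y, 0 <= t -> t <= 1 -> C x -> C y ->
    f ((1 - t) *: x + t *: y) + K / 2 * (t * (1 - t)) * enorm (y - x) ^+ 2
      <= (1 - t) * f x + t * f y.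

(** The convex combination [m] may have no subgradient, so strong convexity is applied at a proximal
    point [w] within 2 L s of it, towards [x] and [y], with weights 1 - t and t. Replacing [m] by
    [w] costs at most 2 L^2 s, and [s] tends to 0. *)
Lemma strongly_convex_onP C L Delta f :
  compact C -> convex_set C -> 0 <= L -> 0 <= Delta -> elipschitz_on C L f ->
  convex_function C f -> strongly_convex_on C Delta f ->
  strongly_convex_jensen C Delta f.
Proof.
move=> kC cC L0 D0 fL cf sf t x y t0 t1 Cx Cy; rewrite -subr_ge0.
apply: (@affine_ge0 _ _ (2 * L ^+ 2)) => s s0 _.
have Cm := convex_setP _ cC t x y t0 t1 Cx Cy.
set m := (1 - t) *: x + t *: y in Cm *.
have si : 0 < s^-1 by rewrite invr_gt0.
have [w [Cw sg]] := prox_subgradient C L f s^-1 m kC cC L0 fL cf si Cm.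
rewrite invrK => mw.
have fm : f m - f w <= L * (2 * L * s).
  apply: le_trans (ler_norm _) (le_trans (fL _ _ Cm Cw) _).
  by rewrite ler_wpM2l.
have := sf w x _ Cw Cx sg; have := sf w y _ Cw Cy sg.
have -> : y - x = (y - w) - (x - w) by apply/rowP => j; rewrite !mxE; ring.
have -> : m - w = (1 - t) *: (x - w) + t *: (y - w).
  by apply/rowP => j; rewrite !mxE; ring.
move: (x - w) (y - w) => u v; rewrite !sqr_enorm !dotprodE (dotprodC v u).
have c0 : 0 <= s^-1 * dotprod ((1 - t) *: u + t *: v) ((1 - t) *: u + t *: v).
  by rewrite mulr_ge0 ?dotprod_ge0// ltW.
(* For the quadratic terms, (1-t)|u|^2 + t|v|^2 exceeds t(1-t)|v - u|^2 by exactly this square. *)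
have := dotprod_ge0 ((1 - t) *: u + t *: v).
move: c0; rewrite !dotprodE (dotprodC v u).
move: (dotprod u u) (dotprod u v) (dotprod v v) s^-1 => a b d k kq q hy hx.
have t1' : 0 <= 1 - t by rewrite subr_ge0.
have {}hx := ler_wpM2l t1' hx; have {}hy := ler_wpM2l t0 hy.
have {}q := mulr_ge0 D0 q; lra.
Qed.

Lemma strongly_convex_jensen_sum C K (I : finType) (F : I -> 'rV[R]_p -> R) :
  (forall i, strongly_convex_jensen C K (F i)) ->
  strongly_convex_jensen C (#|I|%:R * K) (fun x => \sum_i F i x).
Proof.
move=> sF t x y t0 t1 Cx Cy; rewrite !mulr_sumr -big_split/=.
have -> : #|I|%:R * K / 2 * (t * (1 - t)) * enorm (y - x) ^+ 2 =
    \sum_(i : I) (K / 2 * (t * (1 - t)) * enorm (y - x) ^+ 2).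
  by rewrite sumr_const -mulr_natl; ring.
by rewrite -big_split/=; apply: ler_sum => i _; exact: sF.
Qed.

(** In the Jensen inequality on the segment from [x] to [y], bound the middle value below by [f x],
    divide by [t] and let [t] tend to 0. *)
Lemma argmin_quadratic_growth C K f x y : convex_set C ->
  strongly_convex_jensen C K f ->
  C x -> (forall z, C z -> f x <= f z) -> C y ->
  f x + K / 2 * enorm (y - x) ^+ 2 <= f y.
Proof.
move=> cC sf Cx xmin Cy; rewrite -subr_ge0.
apply: (@affine_ge0 _ _ (K / 2 * enorm (y - x) ^+ 2)) => t t0 t1.
have := xmin _ (convex_setP _ cC t x y (ltW t0) (ltW t1) Cx Cy).
have := sf t x y (ltW t0) (ltW t1) Cx Cy.
move: (enorm _ ^+ 2) (f (_ + _)) => r fm h1 h2.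
by rewrite -(pmulr_rge0 _ t0); lra.
Qed.

End convex_optimization.

(** * Sensitivity of the minimizer to one data entry *)

Section sensitivity.
Context {R : realType} {X : Type} {p n : nat}.

(** With r = |x - x'|, adding the quadratic growth of [f] at [x] and of [f'] at [x'] gives K r^2 <=
    (f - f')(x') - (f - f')(x) <= M r. *)
Lemma argmin_perturbation (C : set 'rV[R]_p) (K M : R)
    (f f' : 'rV[R]_p -> R) x x' :
  convex_set C -> strongly_convex_jensen C K f ->
  strongly_convex_jensen C K f' ->
  C x -> (forall z, C z -> f x <= f z) ->
  C x' -> (forall z, C z -> f' x' <= f' z) ->
  0 <= M -> elipschitz_on C M (fun z => f z - f' z) ->
  K * enorm (x - x') <= M.
Proof.
move=> cC sf sf' Cx xmin Cx' xmin' M0 ffL.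
have := argmin_quadratic_growth C K f x x' cC sf Cx xmin Cx'.
have := argmin_quadratic_growth C K f' x' x cC sf' Cx' xmin' Cx.
have := ffL _ _ Cx' Cx; have := ler_norm (f x' - f' x' - (f x - f' x)).
rewrite enormB; have := enorm_ge0 (x - x').
move: (enorm _) => r r0 h1 h2 h3 h4.
have [->|r1] := eqVneq r 0; first by rewrite mulr0.
have rp : 0 < r by rewrite lt_neqAle eq_sym r1.
rewrite -(ler_pM2l rp); lra.
Qed.

Lemma empirical_loss_neighbors (l : X -> 'rV[R]_p -> R) (D D' : n.-tuple X)
    (i : 'I_n) x : (forall j, j != i -> tnth D j = tnth D' j) ->
  empirical_loss l D x - empirical_loss l D' x =
  l (tnth D i) x - l (tnth D' i) x.
Proof.
move=> DD'; rewrite /empirical_loss (bigD1 i)//= [in X in _ - X](bigD1 i)//=.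
rewrite [in X in _ - X](eq_bigr (fun j => l (tnth D j) x)); first by ring.
by move=> j ji; rewrite DD'.
Qed.

Lemma empirical_loss_continuous (C : set 'rV[R]_p) L
    (l : X -> 'rV[R]_p -> R) (D : n.-tuple X) :
  0 <= L -> (forall d, elipschitz_on C L (l d)) ->
  {within C, continuous (empirical_loss l D)}.
Proof.
move=> L0 lL; apply: (elipschitz_within_continuous _ (n%:R * L)).
  by rewrite mulr_ge0.
move=> x y Cx Cy; rewrite /empirical_loss -sumrB.
apply: le_trans (ler_norm_sum _ _ _) _.
have -> : n%:R * L * enorm (x - y) = \sum_(i < n) (L * enorm (x - y)).
  by rewrite sumr_const card_ord -mulr_natl; ring.
by apply: ler_sum => i _; exact: lL.
Qed.

(** The sum of [n] losses has modulus n Delta, and two neighboring sums differ by a difference of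
    two single losses, which is 2 L-Lipschitz. *)
Lemma argmin_sensitivity (C : set 'rV[R]_p) L Delta
    (l : X -> 'rV[R]_p -> R) (D D' : n.-tuple X) :
  C !=set0 -> compact C -> convex_set C -> 0 <= L -> 0 <= Delta ->
  (forall d, convex_function C (l d)) ->
  (forall d, elipschitz_on C L (l d)) ->
  (forall d, strongly_convex_on C Delta (l d)) ->
  neighbors D D' ->
  n%:R * Delta * enorm (argmin_on C (empirical_loss l D) -
                        argmin_on C (empirical_loss l D')) <= 2 * L.
Proof.
move=> C0 kC cC L0 D0 lc lL ls [i [_ DD']].
have sl (E : n.-tuple X) :
    strongly_convex_jensen C (n%:R * Delta) (empirical_loss l E).
  have := strongly_convex_jensen_sum C Delta 'I_n (fun j => l (tnth E j)).
  by rewrite card_ord; apply => j; exact: (strongly_convex_onP C L).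
have minP (E : n.-tuple X) := argmin_onP C (empirical_loss l E) C0 kC
  (empirical_loss_continuous C L l E L0 lL).
apply: (argmin_perturbation C _ _ (empirical_loss l D) (empirical_loss l D')).
- by [].
- exact: sl.
- exact: sl.
- exact: (minP D).1.
- exact: (minP D).2.
- exact: (minP D').1.
- exact: (minP D').2.
- by rewrite mulr_ge0.
- move=> x y Cx Cy; rewrite !(empirical_loss_neighbors _ _ _ i)//.
  have -> : l (tnth D i) x - l (tnth D' i) x -
      (l (tnth D i) y - l (tnth D' i) y) =
    (l (tnth D i) x - l (tnth D i) y) - (l (tnth D' i) x - l (tnth D' i) y).
    by ring.
  apply: le_trans (ler_normB _ _) _.
  have := lL (tnth D i) _ _ Cx Cy; have := lL (tnth D' i) _ _ Cx Cy; lra.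
Qed.

End sensitivity.

(** * Noise calibration and composition of the two stages *)

Lemma out_pert_noise_density_shift {R : realType} {p : nat} (n : nat)
    (L Delta eps' : R) (c b : 'rV[R]_p) : 0 < L -> 0 <= Delta -> 0 <= eps' ->
  n%:R * Delta * enorm c <= 2 * L ->
  out_pert_noise_density n L Delta eps' (b - c) <=
  expR eps' * out_pert_noise_density n L Delta eps' b.
Proof.
move=> L0 D0 e0 nc; rewrite /out_pert_noise_density -expRD ler_expR.
set a := n%:R * Delta * eps' / (2 * L).
have a0 : 0 <= a.
  by rewrite divr_ge0// ?mulr_ge0// ltW.
(* The rate [a] is calibrated to the sensitivity: a shift of norm at most 2 L / (n Delta) changes
   the exponent by at most [eps']. *)
have ac : a * enorm c <= eps'.
  rewrite /a mulrAC ler_pdivrMr ?mulr_gt0//.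
  by have := ler_wpM2l e0 nc; lra.
have := enormD (b - c) c; rewrite subrK => bc.
have := ler_wpM2l a0 bc; lra.
Qed.

Lemma measurable_out_pert_noise_density {R : realType} {p : nat} (n : nat)
    (L Delta eps' : R) :
  measurable_fun setT (@out_pert_noise_density R p n L Delta eps').
Proof.
apply: (@measurableT_comp _ _ _ _ _ _ (@expR R) _
  (fun b : 'rV[R]_p => - (n%:R * Delta * eps' / (2 * L) * enorm b))) => //.
apply: measurableT_comp => //; apply: measurable_funM => //.
exact: measurable_enorm.
Qed.

Theorem theorem4p1 (R : realType) (X : Type) (p n : nat)
    (C : set 'rV[R]_p) (l : X -> 'rV[R]_p -> R) (L Delta eps : R)
    (Agen : n.-tuple X -> (X -> 'rV[R]_p -> R) -> R -> set 'rV[R]_p ->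
      probability 'rV[R]_p R)
    (noise : probability 'rV[R]_p R) :
  C !=set0 -> closed C -> bounded_set C -> convex_set C ->
  0 < L -> 0 < Delta -> 0 < eps ->
  (forall d : X, convex_function C (l d)) ->
  (forall d : X, elipschitz_on C L (l d)) ->
  (forall d : X, strongly_convex_on C Delta (l d)) ->
  (forall Ct : set 'rV[R]_p, Ct !=set0 -> Ct `<=` C -> convex_set Ct ->
    (forall D, outputs_in (Agen D l (eps / 2) Ct) Ct) /\
    differentially_private (eps / 2) (fun D => Agen D l (eps / 2) Ct)) ->
  (* the law of the second step depends measurably on the noise of the first *)
  (forall D S, measurable S -> measurable_fun [set: 'rV[R]_p]
    (fun b => generic_step Agen C l L Delta eps D b S)) ->
  has_density_proportional_to noise
    (out_pert_noise_density n L Delta (eps / 2)) ->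
  differentially_private eps
    (out_pert_generic Agen C l L Delta eps noise).
Proof.
move=> C0 clC bC cC L0 D0 e0 lc lL ls genP gen_meas noiseP D D' DD' S mS.
have kC : compact C by exact: bounded_closed_compact.
(* Neighbors differ at some index, so n >= 1 and ln n >= 0. The radius [r] is then nonnegative and
   each ball contains its center. *)
have n1 : (0 < n)%N by case: DD' => -[i ilt] _; exact: leq_ltn_trans ilt.
have e2 : 0 < eps / 2 by rewrite divr_gt0.
set r := 3 * ln n%:R * (2 * L * p%:R / (Delta * (eps / 2) * n%:R)).
have r0 : 0 <= r.
  rewrite mulr_ge0//.
    by rewrite mulr_ge0// ln_ge0// ler1n.
  by rewrite divr_ge0// ?mulr_ge0// ltW.
pose ball v := [set theta | C theta /\ enorm (theta - eproj C v) <= r].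
have ball0 v : ball v !=set0.
  by exists (eproj C v); split; [exact: eproj_in|rewrite subrr enorm0].
have ballC v : ball v `<=` C by move=> ? [].
have ball_cvx v : convex_set (ball v) by exact: convex_setI_ball.
pose theta (E : n.-tuple X) := argmin_on C (empirical_loss l E).
have stepE E b : generic_step Agen C l L Delta eps E b =
  Agen E l (eps / 2) (ball (theta E + b)) by [].
(* Noise [b] on [D] and noise [b + c] on [D'] produce the same ball. *)
pose c := theta D - theta D'.
pose f b := generic_step Agen C l L Delta eps D' b S.
have mf : measurable_fun setT f by exact: gen_meas.
have mfc : measurable_fun setT (fun b : 'rV[R]_p => f (b + c)).
  exact: measurableT_comp mf (measurable_translate _ c).
rewrite /out_pert_generic.
(* The intermediate integral runs the second stage on [D'] with the balls of [D]. Pointwise in [b]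
   the ball is fixed, so this change costs the factor e^(eps/2) of the second stage; the shift of
   the noise by [c] remains. *)
apply: (@le_trans _ _ (\int[noise]_b ((expR (eps / 2))%:E * f (b + c)%R))%E).
  apply: ge0_le_integral.
  - exact: measurableT.
  - by move=> b _; exact: measure_ge0.
  - exact: gen_meas.
  - exact: measurable_funeM.
  - move=> b _; rewrite /f !stepE.
    have -> : theta D' + (b + c) = theta D + b.
      by apply/rowP => j; rewrite !mxE; ring.
    exact: (genP _ (ball0 _) (ballC _) (ball_cvx _)).2.
have f0 b : (0 <= f b)%E by exact: measure_ge0.
have eps_ge0 : (0 <= (expR (eps / 2))%:E)%E by rewrite lee_fin expR_ge0.
rewrite (ge0_integralZl noise measurableT mfc (fun b _ => f0 _) eps_ge0).
have -> : expR eps = expR (eps / 2) * expR (eps / 2).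
  by rewrite -expRD -splitr.
rewrite EFinM -muleA; apply: lee_wpmul2l => //.
(* The sensitivity bound on [c] supplies the other factor e^(eps/2). *)
have density_le b := out_pert_noise_density_shift n L Delta (eps / 2) c b
  L0 (ltW D0) (ltW e2)
  (argmin_sensitivity C L Delta l D D' C0 kC cC (ltW L0) (ltW D0) lc lL ls DD').
exact: (@integral_density_translate_le _ _ noise
  (out_pert_noise_density n L Delta (eps / 2)) c (NngNum (expR_ge0 (eps / 2)))
  noiseP (measurable_out_pert_noise_density n L Delta (eps / 2))
  (fun=> expR_ge0 _) density_le f mf f0).
Qed.
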